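(* Let $G=(V,E)$ be a two-edge connected finite undirected simple graph that is $P_6$-free or $C_{\geq 5}$-free. Then $G$ contains a $\mathrm{PHC}_3$ if and only if $|V|$ is even or $G$ is non-bipartite.
   Context: A closed walk is a sequence $v_0e_1v_1\cdots e_\ell v_\ell$ with $e_i=\{v_{i-1},v_i\}\in E$ and $v_\ell=v_0$; vertices and edges may be repeated. The visit number of a vertex $v$ is the number of indices $i\in\{1,\dots,\ell\}$ with $v_i=v$. A parity Hamiltonian cycle (PHC) is a closed walk in which every vertex has odd visit number; a $\mathrm{PHC}_3$ is a PHC using each edge at most $3$ times. $P_k$ is the path on $k$ vertices, $C_k$ the cycle on $k$ vertices. A graph is $P_k$-free ($C_k$-free) if it has no induced subgraph isomorphic to $P_k$ ($C_k$); it is $C_{\geq k}$-free if it is $C_{k'}$-free for all $k'\geq k$. *)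

(* Defs.v *)
From mathcomp Require Import all_boot.

Set Implicit Arguments.
Unset Strict Implicit.
Unset Printing Implicit Defensive.

(* A finite simple graph is a symmetric irreflexive relation e : rel V on a
   finType V; an edge is the two-element set of its ends. *)

Definition edge_set (V : finType) (e : rel V) : {set {set V}} :=
  [set [set xy.1; xy.2] | xy : V * V & e xy.1 xy.2].

Definition del_edge (V : finType) (e : rel V) (f : {set V}) : rel V :=
  [rel x y | e x y && ([set x; y] != f)].

(* The graph without vertices is not connected. *)
Definition connected (V : finType) (e : rel V) : Prop :=
  0 < #|V| /\ forall x y : V, connect e x y.

Definition two_edge_connected (V : finType) (e : rel V) : Prop :=
  connected e /\
  forall f : {set V}, f \in edge_set e -> connected (del_edge e f).

Definition bipartite (V : finType) (e : rel V) : Prop :=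
  exists A : {set V}, forall x y : V, e x y -> (x \in A) != (y \in A).

Definition isomorphic (V W : finType) (e : rel V) (h : rel W) : Prop :=
  exists2 phi : V -> W, bijective phi & forall x y, h (phi x) (phi y) = e x y.

Definition induced (V : finType) (e : rel V) (S : {set V}) :
    rel {x : V | x \in S} :=
  [rel x y | e (val x) (val y)].

Definition induced_free (V W : finType) (e : rel V) (h : rel W) : Prop :=
  ~ exists S : {set V}, isomorphic (induced e (S := S)) h.

Definition path_graph (k : nat) : rel 'I_k :=
  [rel i j : 'I_k | (i.+1 == j :> nat) || (j.+1 == i :> nat)].

(* Meaningful for 2 < k: cycle_graph 1 has a loop, cycle_graph 2 is one edge. *)
Definition cycle_graph (k : nat) : rel 'I_k :=
  [rel i j : 'I_k | (i.+1 %% k == j :> nat) || (j.+1 %% k == i :> nat)].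

Definition P_free (k : nat) (V : finType) (e : rel V) : Prop :=
  induced_free e (@path_graph k).

Definition C_free (k : nat) (V : finType) (e : rel V) : Prop :=
  induced_free e (@cycle_graph k).

Definition C_ge_free (k : nat) (V : finType) (e : rel V) : Prop :=
  forall k' : nat, k <= k' -> C_free k' e.

(* The walk v_0 e_1 v_1 ... e_l v_l is given by v0 = v_0 and
   p = [:: v_1; ...; v_l]; the graph being simple, its edges are determined. *)

Definition closed_walk (V : finType) (e : rel V) (v0 : V) (p : seq V) : Prop :=
  path e v0 p /\ last v0 p = v0.

Definition walk_edges (V : finType) (v0 : V) (p : seq V) : seq {set V} :=
  pairmap (fun x y => [set x; y]) v0 p.

(* v_0 itself is not counted: indices run over 1, ..., l. *)
Definition visit_number (V : finType) (p : seq V) (v : V) : nat :=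
  count_mem v p.

Definition is_PHC (V : finType) (e : rel V) (v0 : V) (p : seq V) : Prop :=
  closed_walk e v0 p /\ forall v : V, odd (visit_number p v).

Definition has_PHC_at_most (m : nat) (V : finType) (e : rel V) : Prop :=
  exists (v0 : V) (p : seq V), is_PHC e v0 p /\
    forall f : {set V}, f \in edge_set e -> count_mem f (walk_edges v0 p) <= m.

(* Main.v *)
(* A PHC_3 is an Eulerian closed walk of a connected multigraph on G whose edge
   multiplicities m, read modulo 4, sum to 2 at every vertex. Such labelings
   with values in Z/4 (not necessarily of connected support) exist as soon as
   |V| is even or G is non-bipartite. Choose one for which the relation
   "joined by edges with nonzero label" is inclusion-maximal, and call an edge
   crossing if its ends are not joined.

   Adding +a, -a, +a, ... along an even cycle (or 2 along an odd one) preserves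
   the vertex sums; if at most one label of the cycle becomes 0, its vertices
   are joined afterwards, hence by maximality they already were. Counting the
   choices of a, a cycle of length 3, 4 or 6 carries no crossing edge, and a
   5-cycle with a crossing edge has at least two labels 0 and two labels 2.
   A shortest cycle through an edge is induced, so it has length at most 4 if G
   is C_{>=5}-free, and then G is spanned by one component. If G is P_6-free its
   length is at most 6, and only 5-cycles remain: moving an odd a along a
   5-cycle and a triangle sharing one vertex with it rules out such triangles,
   and then induced copies of P_6 force the rest of G to hang on the 5-cycle in
   a way that a few shifts of 4-cycles contradict. *)

Require Import Defs.
From mathcomp Require Import all_boot all_algebra.
From mathcomp Require Import zify.

Set Implicit Arguments.
Unset Strict Implicit.
Unset Printing Implicit Defensive.

Import GRing.Theory.

(** * Edge multiplicities of walks *)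

Section Walks.

Variables (V : finType) (e : rel V).
Hypotheses (e_sym : symmetric e) (e_irr : irreflexive e).

Definition same_edge (x y a b : V) : bool :=
  (x == a) && (y == b) || (x == b) && (y == a).

(** Indexed by ordered pairs rather than by edge sets, so that it compares pointwise with a
    symmetric multiplicity [r x y]. *)
Fixpoint edge_use (v : V) (p : seq V) (x y : V) : nat :=
  if p is u :: q then same_edge x y v u + edge_use u q x y else 0.

Lemma same_edgeC x y a b : same_edge x y a b = same_edge y x a b.
Proof. by rewrite /same_edge orbC andbC [(x == a) && _]andbC. Qed.

Lemma edge_useC v p x y : edge_use v p x y = edge_use v p y x.
Proof. by elim: p v => //= u q IH v; rewrite same_edgeC IH. Qed.

Lemma edge_use_cat v p q x y :
  edge_use v (p ++ q) x y = edge_use v p x y + edge_use (last v p) q x y.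
Proof. by elim: p v => //= u p IH v; rewrite IH addnA. Qed.

Lemma edge_e x y : e x y -> x != y.
Proof. by apply: contraTneq => ->; rewrite e_irr. Qed.

Lemma same_edgeE x y a b : a != b ->
  same_edge x y a b = (x == a) * (y == b) + (x == b) * (y == a) :> nat.
Proof.
rewrite /same_edge => ab; case: (eqVneq x a) => [->|_].
  by rewrite (negbTE ab) mul1n mul0n addn0 orbF.
by rewrite mul0n add0n; case: (x == b) (y == a) => [] [].
Qed.

Lemma set2_same_edge x y a b : ([set a; b] == [set x; y]) = same_edge x y a b.
Proof.
apply/eqP/idP => [E0|].
  have E z : (z \in [set a; b]) = (z \in [set x; y]) by rewrite E0.
  have := E x; have := E y; have := E a; have := E b.
  rewrite !inE !eqxx !orbT /same_edge.
  rewrite (eq_sym b x) (eq_sym b y) (eq_sym a x) (eq_sym a y).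
  by case: (x == a) (x == b) (y == a) (y == b) => [] [] [] [].
by case/orP=> /andP[/eqP-> /eqP->] //; rewrite setUC.
Qed.

Lemma count_walk_edges v p x y :
  count_mem [set x; y] (walk_edges v p) = edge_use v p x y.
Proof. by elim: p v => //= u q IH v; rewrite set2_same_edge IH. Qed.

Lemma sum_eq_op (b : V) : \sum_(i : V) (i == b) = 1.
Proof. by rewrite (bigD1 b) //= eqxx big1 // => i /negbTE->. Qed.

Lemma sum_count_mem p : \sum_(v : V) count_mem v p = size p.
Proof.
elim: p => [|u q IH] /=; first by rewrite big1.
rewrite big_split /= IH -[RHS]add1n; congr (_ + _).
by rewrite -(sum_eq_op u); apply: eq_bigr => i _; rewrite eq_sym.
Qed.

(** Each occurrence of [z] in [p] is entered once and, unless it is the end of the walk, left once;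
    the start is left without being entered. Hence twice the visit number, corrected at both
    ends. *)
Lemma edge_use_degree v p z : path e v p ->
  \sum_y edge_use v p z y + (z == last v p) = (count_mem z p).*2 + (z == v).
Proof.
elim: p v => [|u q IH] v /=; first by rewrite big1.
case/andP=> evu /IH; rewrite big_split /= => E.
have -> : \sum_y same_edge z y v u = (z == v) + (z == u).
  rewrite (eq_bigr (fun y => (z == v) * (y == u) + (z == u) * (y == v))).
    rewrite big_split -!big_distrr /=.
    by rewrite !sum_eq_op !muln1.
  by move=> y _; rewrite same_edgeE // edge_e.
by rewrite -addnA E doubleD (eq_sym u z); case: (z == u) => /=; lia.
Qed.

Lemma edge_use_mem v p x y :
  0 < edge_use v p x y -> (x \in v :: p) && (y \in v :: p).
Proof.
elim: p v => //= u q IH v; rewrite addn_gt0 => /orP[|/IH/andP[a b]].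
  by rewrite lt0b !inE => /orP[/andP[/eqP-> /eqP->]|/andP[/eqP-> /eqP->]];
     rewrite !eqxx ?orbT.
by rewrite inE a inE b !orbT.
Qed.

Lemma edge_use_edge v p x y : path e v p -> 0 < edge_use v p x y -> e x y.
Proof.
elim: p v => //= u q IH v /andP[evu pq]; rewrite addn_gt0 => /orP[|/(IH _ pq)//].
by rewrite lt0b => /orP[/andP[/eqP-> /eqP->]|/andP[/eqP-> /eqP->]] //; rewrite e_sym.
Qed.

End Walks.

(** * Eulerian closed walks in connected multigraphs with even degrees *)

Section Euler.

Variables (V : finType) (e : rel V).
Hypotheses (e_sym : symmetric e) (e_irr : irreflexive e).

Lemma edge_use_path (r : V -> V -> nat) v p :
  (forall x y, 0 < r x y -> e x y) ->
  (forall x y, edge_use v p x y <= r x y) -> path e v p.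
Proof.
move=> re; elim: p v => //= u q IH v ler; rewrite IH ?andbT.
  by apply: re; apply: leq_trans (ler v u); rewrite /same_edge !eqxx.
by move=> x y; apply: leq_trans (ler x y); rewrite leq_addl.
Qed.

(* A longest trail from [x] can only stop at [x], by parity. *)
Lemma closed_trail (r : V -> V -> nat) x y :
  (forall a b, r a b = r b a) -> (forall a b, 0 < r a b -> e a b) ->
  (forall a, ~~ odd (\sum_b r a b)) -> 0 < r x y ->
  exists p, [/\ last x p = x, p != [::] &
                forall a b, edge_use x p a b <= r a b].
Proof.
move=> rC re rev rxy.
have trail n : (exists p, [/\ last x p = x, p != [::] &
                forall a b, edge_use x p a b <= r a b]) \/
   exists p, size p = n /\ forall a b, edge_use x p a b <= r a b.
  elim: n => [|n [|[p [sp ler]]]]; [by right; exists [::] | by left | ].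
  case: (boolP ((last x p == x) && (p != [::]))) => [/andP[/eqP lx pn]|H].
    by left; exists p.
  right; set w := last x p.
  suff [b lt] : exists b, edge_use x p w b < r w b.
    exists (rcons p b); rewrite size_rcons sp; split=> // a c.
    rewrite -cats1 edge_use_cat /= addn0 -/w.
    case: (boolP (same_edge a c w b)) => /= S; last by rewrite addn0.
    rewrite addn1; case/orP: S => /andP[/eqP-> /eqP->] //.
    by rewrite edge_useC rC.
  case: (eqVneq p [::]) => [p0|pn0].
    by exists y; rewrite /w p0.
  have wx : w != x by move: H; rewrite pn0 andbT.
  apply/existsP; apply: contraT; rewrite negb_exists => /forallP nlt.
  have pp := edge_use_path re ler.
  have := edge_use_degree e_irr w pp.
  rewrite (eq_bigr (r w)) => [|b _].
    rewrite eqxx (negbTE wx) => E; have := rev w; have := congr1 odd E.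
    by rewrite !oddD odd_double /= addbT => ->.
  by apply/eqP; rewrite eqn_leq ler leqNgt nlt.
(* A trail this long is impossible: its uses, summed over ordered pairs, are twice its length and at
   most the total of [r]. *)
have [//|[p [sp ler]]] := trail (\sum_a \sum_b r a b).+1.
have pp := edge_use_path re ler.
have: \sum_a \sum_b edge_use x p a b <= \sum_a \sum_b r a b.
  by apply: leq_sum => a _; apply: leq_sum => b _.
have : \sum_a (\sum_b edge_use x p a b + (a == last x p)) =
       \sum_a ((count_mem a p).*2 + (a == x)).
  by apply: eq_bigr => a _; apply: edge_use_degree.
rewrite !big_split /= !sum_eq_op -(eq_bigr _ (fun a _ => muln2 _)) -big_distrl /= sum_count_mem sp.
lia.
Qed.

Lemma euler_closed_walk (r : V -> V -> nat) (v0 : V) :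
  (forall a b, r a b = r b a) -> (forall a b, 0 < r a b -> e a b) ->
  (forall a, ~~ odd (\sum_b r a b)) ->
  (forall a b, connect [rel x y | 0 < r x y] a b) ->
  exists p, [/\ path e v0 p, last v0 p = v0 &
                forall a b, edge_use v0 p a b = r a b].
Proof.
move=> rC re rev rcon.
suff IH n p : last v0 p = v0 -> (forall a b, edge_use v0 p a b <= r a b) ->
    \sum_a \sum_b (r a b - edge_use v0 p a b) <= n ->
    exists p, last v0 p = v0 /\ forall a b, edge_use v0 p a b = r a b.
  have [||p [lp up]] := IH _ [::] _ _ (leqnn _) => //.
  exists p; split => //; apply: (@edge_use_path r) => // a b.
  by rewrite up.
elim: n p => [|n IH] p lp ler.
  rewrite leqn0 => /eqP/esym/eqP; rewrite eq_sym sum_nat_eq0 => /forall_inP S.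
  exists p; split=> // a b; apply/eqP; rewrite eqn_leq ler /= -subn_eq0.
  have := S a isT; rewrite sum_nat_eq0 => /forall_inP; exact.
move=> len.
case: (boolP [exists a, exists b, edge_use v0 p a b < r a b]); last first.
  move=> H; exists p; split=> // a b; apply/eqP; rewrite eqn_leq ler leqNgt /=.
  by apply: contra H => lt; apply/existsP; exists a; apply/existsP; exists b.
case/existsP=> a /existsP[b lt].
(* If every vertex of the walk were exhausted, each edge at such a vertex would be used, so the walk
   would contain its other end; by connectivity the walk would then reach [a]. *)
have [x xp [y ltx]] : exists2 x, x \in v0 :: p &
                      exists y, edge_use v0 p x y < r x y.
  case: (boolP [exists x in v0 :: p, exists y, edge_use v0 p x y < r x y]).
    by case/exists_inP=> x xp /existsP; exists x.
  rewrite negb_exists_in => full.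
  exists a; last by exists b.
  case/connectP: (rcon v0 a) => s ps ->.
  have closed c : c \in v0 :: p -> path [rel x y | 0 < r x y] c s ->
      last c s \in v0 :: p.
    elim: s c {ps} => //= d s IHs c cp /andP[rcd ps]; apply: (IHs d) ps.
    have := forall_inP full _ cp; rewrite negb_exists => /forallP/(_ d).
    rewrite -leqNgt => /(leq_trans rcd) /edge_use_mem /andP[] //.
  by apply: closed => //; apply: mem_head.
have [q [lq qn leq]] : exists q, [/\ last x q = x, q != [::] & forall a b,
    edge_use x q a b <= r a b - edge_use v0 p a b].
  apply: (@closed_trail _ x y) => [c d|c d|c|].
  - by rewrite rC edge_useC.
  - by move=> lt0; apply: re; lia.
  - have := edge_use_degree e_irr c (edge_use_path re ler).
    rewrite lp => /addIn E; have := rev c.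
    have -> : \sum_b r c b = \sum_b (r c b - edge_use v0 p c b)
                           + \sum_b edge_use v0 p c b.
      by rewrite -big_split; apply: eq_bigr => d _; rewrite /= subnK.
    by rewrite E oddD odd_double addbF.
  - by rewrite subn_gt0.
case/splitPl: xp lp ler len ltx lt leq => p1 p2 lx lp ler len ltx lt leq.
have useE c d : edge_use v0 (p1 ++ q ++ p2) c d =
    edge_use v0 (p1 ++ p2) c d + edge_use x q c d.
  by rewrite !edge_use_cat lx lq; lia.
apply: (IH (p1 ++ q ++ p2)).
- by move: lp; rewrite !last_cat lx lq.
- by move=> c d; rewrite useE; have := leq c d; have := ler c d; lia.
rewrite -ltnS; apply: leq_trans len.
(* The first step from [x] to [u] of the nonempty [q] makes the decrease strict. *)
case: q qn lq leq useE => // u q _ lq leq useE.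
rewrite [X in _ < X](bigD1 x) //= (bigD1 x) //=.
rewrite [X in _ < X + _](bigD1 u) //= [X in X + _ < _](bigD1 u) //=.
have L1 : r x u - edge_use v0 (p1 ++ (u :: q) ++ p2) x u <
          r x u - edge_use v0 (p1 ++ p2) x u.
  by rewrite useE; have := leq x u; rewrite /= /same_edge !eqxx /=; lia.
have L2 c (P : pred V) : \sum_(i | P i) (r c i - edge_use v0 (p1 ++ (u :: q) ++ p2) c i) <=
    \sum_(i | P i) (r c i - edge_use v0 (p1 ++ p2) c i).
  by apply: leq_sum => i _; rewrite useE; lia.
have L3 : \sum_(i | i != x) \sum_b (r i b - edge_use v0 (p1 ++ (u :: q) ++ p2) i b) <=
  \sum_(i | i != x) \sum_b (r i b - edge_use v0 (p1 ++ p2) i b).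
  by apply: leq_sum => i _; apply: L2.
have := L2 x (fun i => i != u); move: L1 L3; rewrite /=; lia.
Qed.

End Euler.

(** * Labelings in Z/4, alternating shifts along closed walks, and maximality *)

Section Labelings.

Variables (V : finType) (e : rel V).
Hypotheses (e_sym : symmetric e) (e_irr : irreflexive e).

Local Open Scope ring_scope.

Implicit Types (m d : V -> V -> 'Z_4) (a : 'Z_4) (u v w x y z : V) (p q : seq V).

Definition feasible m : Prop :=
  [/\ forall x y, m x y = m y x, forall x y, m x y != 0 -> e x y
    & forall x, \sum_y m x y = 2%:R].

Definition linked m : rel V := connect [rel x y | m x y != 0].

Definition maximal m : Prop :=
  feasible m /\ forall m', feasible m' ->
    (forall x y, linked m x y -> linked m' x y) ->
    forall x y, linked m' x y -> linked m x y.

Lemma linked_sym m : feasible m -> symmetric (linked m).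
Proof.
by case=> mC _ _; apply: sym_connect_sym => x y /=; rewrite mC.
Qed.

(** Encoding labelings as finite functions allows a choice with the most linked pairs; largest
    cardinality implies inclusion-maximality. *)
Lemma maximal_exists m0 : feasible m0 -> exists m, maximal m.
Proof.
move=> f0; pose lab (f : {ffun V * V -> 'Z_4}) x y := f (x, y).
pose feasb f := [&& [forall x, forall y, lab f x y == lab f y x],
  [forall x, forall y, (lab f x y != 0) ==> e x y] &
  [forall x, \sum_y lab f x y == 2%:R]].
have feasP f : reflect (feasible (lab f)) (feasb f).
  apply: (iffP and3P) => [[/forallP A /forallP B /forallP C]|[A B C]]; split.
  - by move=> x y; apply/eqP/(forallP (A x)).
  - by move=> x y; apply/implyP/(forallP (B x)).
  - by move=> x; apply/eqP.
  - by apply/forallP => x; apply/forallP => y; apply/eqP.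
  - by apply/forallP => x; apply/forallP => y; apply/implyP/B.
  - by apply/forallP => x; apply/eqP.
pose toff m : {ffun V * V -> 'Z_4} := [ffun xy => m xy.1 xy.2].
have labK m : forall x y, lab (toff m) x y = m x y by move=> x y; rewrite /lab ffunE.
have feasE m : feasible m -> feasb (toff m).
  case=> A B C; apply/feasP; split=> [x y|x y|x]; rewrite ?labK //; first exact: B.
  by under eq_bigr do rewrite labK.
have linkE m : linked (lab (toff m)) =2 linked m.
  by apply: eq_connect => x y /=; rewrite labK.
pose links f := #|[set xy | linked (lab f) xy.1 xy.2]|.
case: (arg_maxnP links (feasE _ f0)) => f /feasP ff fmax.
exists (lab f); split=> // m' fm' sub x y lxy.
have S : [set xy | linked (lab f) xy.1 xy.2] \subset
         [set xy | linked (lab (toff m')) xy.1 xy.2].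
  by apply/subsetP => -[c d]; rewrite !inE linkE; apply: sub.
have /eqP E := fmax _ (feasE _ fm').
have /setP/(_ (x, y)) : [set xy | linked (lab f) xy.1 xy.2] =
         [set xy | linked (lab (toff m')) xy.1 xy.2].
  by apply/eqP; rewrite eqEcard S; apply: fmax; apply: feasE.
by rewrite !inE linkE lxy.
Qed.

(** The alternating shift along an arbitrary walk: on an edge used several times the signed
    contributions add up. *)
Fixpoint shift a v p x y : 'Z_4 :=
  if p is u :: q then a *+ same_edge x y v u + shift (- a) u q x y else 0.

Lemma shiftC a v p x y : shift a v p x y = shift a v p y x.
Proof. by elim: p a v => //= u q IH a v; rewrite same_edgeC IH. Qed.

Lemma shift_unused a v p x y : edge_use v p x y = 0%N -> shift a v p x y = 0.
Proof.
elim: p a v => //= u q IH a v /eqP; rewrite addn_eq0 => /andP[/eqP-> /eqP/IH->].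
by rewrite addr0.
Qed.

Lemma shift_used a v p x y : shift a v p x y != 0 -> (0 < edge_use v p x y)%N.
Proof. by rewrite lt0n; apply: contra => /eqP/shift_unused->. Qed.

(** Consecutive steps cancel at the vertex between them, so only the two ends contribute; the sign
    at the last vertex records the parity of the length. *)
Lemma shift_sum a v p z : path e v p ->
  \sum_y shift a v p z y =
  a *+ (z == v) - ((-1) ^+ size p * a) *+ (z == last v p).
Proof.
elim: p a v => [|u q IH] a v /=; first by rewrite big1 // expr0 mul1r subrr.
case/andP=> evu /IH; rewrite big_split /= => ->.
rewrite (eq_bigr (fun y => a *+ (z == v) *+ (y == u) + a *+ (z == u) *+ (y == v))).
  rewrite big_split /= !sumrMnr !sum_eq_op !mulr1n -addrA; congr (_ + _).
  by rewrite exprS mulN1r mulrN mulNr mulNrn addNKr.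
by move=> y _; rewrite same_edgeE ?(edge_e e_irr) // mulrnDr !mulrnA.
Qed.

Lemma feasibleD m d : feasible m -> (forall x y, d x y = d y x) ->
  (forall x y, d x y != 0 -> e x y) -> (forall x, \sum_y d x y = 0) ->
  feasible (fun x y => m x y + d x y).
Proof.
case=> mC me ms dC de ds; split=> [x y|x y|x].
- by rewrite mC dC.
- case: (eqVneq (d x y) 0) => [->|/de //]; rewrite addr0; exact: me.
- by rewrite big_split /= ms ds addr0.
Qed.

Lemma shift_edge a v p x y : path e v p -> shift a v p x y != 0 -> e x y.
Proof. by move=> pp /shift_used/(edge_use_edge e_sym pp). Qed.

Lemma shift_sum0 a v p z : path e v p -> last v p = v ->
  (odd (size p) -> a + a = 0) -> \sum_y shift a v p z y = 0.
Proof.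
move=> pp lp aa; rewrite shift_sum // lp -signr_odd.
case: (odd _) aa => [/(_ isT) aa|_]; last by rewrite mul1r subrr.
by rewrite mulN1r mulNrn opprK -mulrnDl aa mul0rn.
Qed.

Fixpoint kills a (s : seq 'Z_4) : nat :=
  if s is l :: s' then ((l + a == 0)%R + kills (- a)%R s')%N else 0%N.

#[global] Arguments kills a%_R s.

(** At a given position, each label becomes 0 for exactly one of the four values of [a]. *)
Lemma kills_sum s :
  (kills 0 s + kills 1 s + kills 2%:R s + kills 3%:R s)%N = size s.
Proof.
elim: s => //= l s IH.
have -> : - 1 = 3%:R :> 'Z_4 by apply/eqP.
have -> : - 2%:R = 2%:R :> 'Z_4 by apply/eqP.
have -> : - 3%:R = 1 :> 'Z_4 by apply/eqP.
rewrite oppr0 -IH.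
have : ((l + 0 == 0)%R + (l + 1 == 0)%R + (l + 2%:R == 0)%R + (l + 3%:R == 0)%R = 1)%N.
  by case: l => -[|[|[|[]]]].
move: (kills 0 s) (kills 1 s) (kills 2%:R s) (kills 3%:R s) => k0 k1 k2 k3.
by move: (l + 0 == 0) (l + 1 == 0) (l + 2%:R == 0) (l + 3%:R == 0) => [] [] [] [] //= _; lia.
Qed.

Fixpoint trail v p : bool :=
  if p is u :: q then (edge_use u q v u == 0%N) && trail u q else true.

Lemma eq_pairmap_used (T : Type) (f g : V -> V -> T) v p :
  (forall x y, (0 < edge_use v p x y)%N -> f x y = g x y) ->
  pairmap f v p = pairmap g v p.
Proof.
elim: p v => //= u q IH v E; congr (_ :: _).
  by apply: E; rewrite /same_edge !eqxx.
by apply: IH => x y xy; apply: E; rewrite addn_gt0 xy orbT.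
Qed.

Lemma same_edge_use v p x y u w :
  same_edge x y u w -> edge_use v p x y = edge_use v p u w.
Proof. by case/orP=> /andP[/eqP-> /eqP->] //; rewrite edge_useC. Qed.

(** On a trail every edge receives exactly one term of the shift, so [kills] counts the zeros of the
    shifted labels. *)
Lemma zeros_shift m a v p : trail v p ->
  count_mem 0 (pairmap (fun x y => m x y + shift a v p x y) v p) =
  kills a (pairmap m v p).
Proof.
elim: p m a v => //= u q IH m a v /andP[/eqP use0 tq].
rewrite /same_edge !eqxx /= mulr1n (shift_unused _ use0) addr0; congr (_ + _)%N.
rewrite -IH //; congr (count _ _); apply: eq_pairmap_used => x y xy.
case S: (_ || _); last by rewrite mulr0n add0r.
by move: xy; rewrite (same_edge_use _ _ S) use0.
Qed.

Lemma use_ends u q : uniq (u :: q) ->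
  (1 < size q)%N -> edge_use u q (last u q) u = 0%N.
Proof.
case: q => //= w q; rewrite inE negb_or => /and3P[/andP[uw uq] wq _] q0.
have lq : last w q \in q.
  by case: q q0 {uq wq} => //= c q _; apply: mem_last.
apply/eqP; rewrite addn_eq0; apply/andP; split.
  rewrite eqb0 negb_or !negb_and eqxx orbF; apply/andP; split.
    by rewrite (memPn uq _ lq).
  by rewrite (memPn wq _ lq).
rewrite -leqn0 leqNgt; apply/negP => /edge_use_mem /andP[_].
by rewrite inE (negbTE uw) (negbTE uq).
Qed.

Lemma trail_path u q : uniq (u :: q) -> trail u q.
Proof.
elim: q u => //= w q IH u /andP[uq /IH->]; rewrite andbT -leqn0 leqNgt.
by apply: contra uq => /edge_use_mem /andP[].
Qed.

Lemma trail_cycle v p : uniq p -> last v p = v -> (2 < size p)%N -> trail v p.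
Proof.
case: p => //= u q up lp sq; rewrite trail_path // andbT.
by rewrite -{1}lp use_ends.
Qed.

(** Cut at the single bad step, the walk falls into two pieces, each joined to one end of the walk;
    for a closed walk the two ends coincide. *)
Lemma almost_path (r : rel V) v p : symmetric r -> last v p = v ->
  (count negb (pairmap r v p) <= 1)%N -> {in v :: p &, forall x y, connect r x y}.
Proof.
move=> r_sym lp; have cC := sym_connect_sym r_sym.
have full w q : count negb (pairmap r w q) = 0%N -> {in w :: q, forall x, connect r w x}.
  elim: q w => [|u q IH] w /=; first by move=> _ x; rewrite inE => /eqP->.
  case rwu : (r w u) => //= /IH uq x; rewrite inE => /predU1P[-> //|/uq].
  by apply: connect_trans; apply: connect1.
have either w q : (count negb (pairmap r w q) <= 1)%N ->
    {in w :: q, forall x, connect r w x || connect r (last w q) x}.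
  elim: q w => [|u q IH] w /=; first by move=> _ x; rewrite inE => /eqP->; rewrite connect0.
  case rwu : (r w u) => /= uq1 x; rewrite inE => /predU1P[->|xq]; rewrite ?connect0 //.
    case/orP: (IH u uq1 x xq) => [ux|->]; last by rewrite orbT.
    by rewrite (connect_trans _ ux) // connect1.
  have qu : {in u :: q, forall z, connect r u z} by apply: full; lia.
  have -> : connect r (last u q) x; last by rewrite orbT.
  by apply: connect_trans (qu _ xq); rewrite cC qu ?mem_last.
move=> /either vp x y /vp; rewrite lp orbb cC => vx /vp.
by rewrite lp orbb; apply: connect_trans.
Qed.

Lemma cycle_linked m v p : feasible m -> last v p = v ->
  (count_mem 0%R (pairmap m v p) <= 1)%N -> {in v :: p &, forall x y, linked m x y}.
Proof.
case=> mC _ _ lp; move=> z1; apply: almost_path => // [x y|]; first by rewrite /= mC.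
suff -> : pairmap [rel x y | m x y != 0] v p = map (predC1 0) (pairmap m v p).
  by rewrite count_map (eq_count (a2 := pred1 0)) // => x; rewrite /= negbK.
by elim: p v {lp z1} => //= u q IH v; rewrite IH.
Qed.

(** A nonzero label of [m] either survives in [m'] or has both ends in [D], which [m'] links; so no
    link is lost, and maximality forbids new ones. As [m'] is maximal again, results on maximal
    labelings apply to it too. *)
Lemma maximal_linked m m' (D : pred V) : maximal m -> feasible m' ->
  (forall x y, m x y != m' x y -> D x && D y) ->
  {in D &, forall x y, linked m' x y} ->
  maximal m' /\ forall x y, linked m' x y = linked m x y.
Proof.
move=> [fm mm] fm' diff Dm'.
have sub x y : linked m x y -> linked m' x y.
  apply: connect_sub => {}x {}y /= mxy.
  case: (eqVneq (m x y) (m' x y)) => [E|/diff/andP[Dx Dy]]; last exact: Dm'.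
  by apply: connect1; rewrite /= -E.
have E x y : linked m' x y = linked m x y by apply/idP/idP; [apply: mm | apply: sub].
split=> //; split=> // m2 fm2 sub2 x y lxy; rewrite E; apply: mm lxy => //.
by move=> ? ? ?; apply: sub2; rewrite E.
Qed.

Lemma shift_maximal m a v p : maximal m -> path e v p -> uniq p ->
  last v p = v -> (2 < size p)%N -> (odd (size p) -> a + a = 0) ->
  (kills a (pairmap m v p) <= 1)%N ->
  let m' := fun x y => m x y + shift a v p x y in
  [/\ maximal m', forall x y, linked m' x y = linked m x y
    & {in v :: p &, forall x y, linked m x y}].
Proof.
move=> mm pp up lp sp aa k1 m'.
have fm' : feasible m'.
  apply: feasibleD; first by case: mm.
  - by move=> x y; apply: shiftC.
  - by move=> x y; apply: shift_edge.
  - by move=> x; apply: shift_sum0.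
have lm' : {in v :: p &, forall x y, linked m' x y}.
  by apply: cycle_linked => //; rewrite zeros_shift ?trail_cycle.
have [|Mm' E] := @maximal_linked m m' [in v :: p] mm fm' _ lm'.
  move=> x y; rewrite -{1}[m x y]addr0 (inj_eq (addrI _)) eq_sym.
  by move=> /shift_used/edge_use_mem.
by split=> // x y xv yv; rewrite -E; apply: lm'.
Qed.

Lemma kills2 s : kills 2%:R s = count_mem 2%:R s.
Proof.
elim: s => //= l s <-; have -> : - 2%:R = 2%:R :> 'Z_4 by apply/eqP.
by congr (_ + _)%N; case: l => -[|[|[|[]]]].
Qed.

Lemma kills0 s : kills 0 s = count_mem 0 s.
Proof. by elim: s => //= l s <-; rewrite addr0 oppr0. Qed.

(** Otherwise every admissible shift would kill at least two labels. On 4- and 6-cycles all four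
    shifts are admissible, which needs 8 labels; on a triangle the shifts 0 and 2 are, which needs
    4. *)
Lemma short_cycle_linked m v p : maximal m -> path e v p -> uniq p ->
  last v p = v -> size p \in [:: 3; 4; 6]%N -> {in v :: p &, forall x y, linked m x y}.
Proof.
move=> mm pp up lp sp; have fm : feasible m by case: mm.
case: (leqP (count_mem 0%R (pairmap m v p)) 1) => [|z2]; first exact: cycle_linked.
have p2 : (2 < size p)%N by move: sp; rewrite !inE => /or3P[]/eqP->.
have shiftP a : (odd (size p) -> a + a = 0) ->
    (kills a (pairmap m v p) <= 1)%N -> {in v :: p &, forall x y, linked m x y}.
  by move=> aa ka; case: (shift_maximal mm pp up lp p2 aa ka).
have := kills_sum (pairmap m v p); rewrite size_pairmap kills0 => ks.
case: (boolP (odd (size p))) => [podd|peven].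
  apply: (shiftP 2%:R) => [_|]; first by apply/eqP.
  by move: sp podd ks; rewrite !inE => /or3P[]/eqP-> //; lia.
have even a : odd (size p) -> a + a = 0 by move=> o; rewrite o in peven.
case: (leqP (kills 1 (pairmap m v p)) 1) => [|k1]; first exact: (shiftP 1 (even _)).
case: (leqP (kills 2%:R (pairmap m v p)) 1) => [|k2].
  exact: (shiftP _ (even _)).
apply: (shiftP 3%:R (even _)).
by move: sp ks k1 k2 z2; rewrite !inE => /or3P[]/eqP->; lia.
Qed.

Lemma five_cycle_linked m v p : maximal m -> path e v p -> uniq p ->
  last v p = v -> size p = 5 ->
  (count_mem 0%R (pairmap m v p) <= 1)%N || (count_mem 2%:R%R (pairmap m v p) <= 1)%N ->
  {in v :: p &, forall x y, linked m x y}.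
Proof.
move=> mm pp up lp sp /orP[|twos]; first by apply: cycle_linked => //; case: mm.
rewrite -kills2 in twos.
have two2 : odd (size p) -> 2%:R + 2%:R = 0 :> 'Z_4 by move=> _; apply/eqP.
by case: (shift_maximal mm pp up lp _ two2 twos); rewrite ?sp.
Qed.

(* Going once round both odd cycles is an even closed walk, so odd values may
   be shifted along it; on [p] they only interfere with the at most one label
   that is neither 0 nor 2. *)
Lemma butterfly_linked m v p q : maximal m ->
  path e v p -> uniq p -> last v p = v -> size p = 5 ->
  path e v q -> uniq q -> last v q = v -> size q = 3 ->
  (forall x, x \in p -> x \in q -> x = v) ->
  {in v :: p &, forall x y, linked m x y}.
Proof.
move=> mm pp up lp sp pq uq lq sq pqv.
case: (boolP ((count_mem 0%R (pairmap m v p) <= 1)%N ||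
              (count_mem 2%:R%R (pairmap m v p) <= 1)%N)).
  exact: five_cycle_linked.
rewrite negb_or -!ltnNge => /andP[z2 t2].
have := kills_sum (pairmap m v p); rewrite size_pairmap kills0 kills2 sp => ksp.
have := kills_sum (pairmap m v q); rewrite size_pairmap sq => ksq.
have vp : v \in p by rewrite -lp; case: (p) sp => //= u p' _; apply: mem_last.
have vq : v \in q by rewrite -lq; case: (q) sq => //= u q' _; apply: mem_last.
(* Since 0 and 2 kill at least four of the five labels of [p], both 1 and 3 kill at most one; on the
   three edges of [q], at most one of 1 and 3 kills two. *)
have [a kpa kqa] : exists2 a, (kills a (pairmap m v p) <= 1)%N &
                             (kills (- a) (pairmap m v q) <= 1)%N.
  case: (leqP (kills 1 (pairmap m v q)) 1) => k1.
    exists 3%:R; first by lia.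
    by have -> : - 3%:R = 1 :> 'Z_4 by apply/eqP.
  exists 1; first by lia.
  by have -> : - 1 = 3%:R :> 'Z_4 by [apply/eqP]; lia.
pose m' x y := m x y + (shift a v p x y + shift (- a) v q x y).
have memv (s : seq V) x : v \in s -> (x \in v :: s) = (x \in s).
  by move=> vs; rewrite inE; case: eqP => // ->; rewrite vs.
have disj x y : (0 < edge_use v p x y)%N -> edge_use v q x y = 0%N.
  move=> upxy; apply/eqP; rewrite -leqn0 leqNgt; apply/negP => uqxy.
  have /andP[] := edge_use_mem upxy; have /andP[] := edge_use_mem uqxy.
  rewrite !memv // => xq yq xp yp; have := edge_use_edge e_sym pp upxy.
  by rewrite (pqv x xp xq) (pqv y yp yq) e_irr.
have fm' : feasible m'.
  apply: feasibleD; first by case: mm.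
  - by move=> x y; rewrite !(shiftC _ _ _ x).
  - move=> x y; case: (eqVneq (shift a v p x y) 0) => [->|/shift_edge->//].
    by rewrite add0r; apply: shift_edge.
  - move=> x; rewrite big_split /= !shift_sum // sp sq lp lq.
    have -> : (-1) ^+ 5 = -1 :> 'Z_4 by apply/eqP.
    have -> : (-1) ^+ 3 = -1 :> 'Z_4 by apply/eqP.
    by rewrite !mulN1r !mulNrn !opprK -opprD subrr.
have Lp : {in v :: p &, forall x y, linked m' x y}.
  apply: cycle_linked => //; rewrite -(zeros_shift m a) ?trail_cycle ?sp // in kpa.
  rewrite (@eq_pairmap_used _ _ (fun x y => m x y + shift a v p x y)) // => x y xy.
  by rewrite /m' (shift_unused _ (disj _ _ xy)) addr0.
have Lq : {in v :: q &, forall x y, linked m' x y}.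
  apply: cycle_linked => //; rewrite -(zeros_shift m (- a)) ?trail_cycle ?sq // in kqa.
  rewrite (@eq_pairmap_used _ _ (fun x y => m x y + shift (- a) v q x y)) // => x y xy.
  rewrite /m' [shift a v p x y]shift_unused ?add0r //; apply/eqP.
  by rewrite -leqn0 leqNgt; apply: contraL xy => /disj->.
have [||_ E] := @maximal_linked m m' [in p ++ q] mm fm'.
- move=> x y; rewrite -{1}[m x y]addr0 (inj_eq (addrI _)) eq_sym /= !mem_cat.
  case: (eqVneq (shift a v p x y) 0) => [->|/shift_used/edge_use_mem/andP[]].
    by rewrite add0r => /shift_used/edge_use_mem; rewrite !memv // => /andP[-> ->]; rewrite !orbT.
  by rewrite !memv // => -> ->.
- have Lv x : x \in p ++ q -> linked m' v x.
    by rewrite mem_cat => /orP[xp|xq]; [apply: Lp | apply: Lq]; rewrite ?mem_head ?memv.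
  move=> x y xD yD; apply: connect_trans (Lv y yD).
  by rewrite -/(linked m' x v) linked_sym ?Lv.
by move=> x y xp yp; rewrite -E; apply: Lp.
Qed.

(** Adding alternating 2 (which equals -2) along a walk from [v0] to each vertex [v] gives the sum 2
    everywhere, with an excess of 2|V| at [v0]. For |V| odd the missing 2 comes from an odd closed
    walk through [v0]. *)
Lemma feasible_exists : connected e -> ~~ odd #|V| \/ ~ bipartite e ->
  exists m, feasible m.
Proof.
case=> /card_gt0P[v0 _] econ H.
have /fin_all_exists[W WP] (v : V) : exists p, path e v0 p /\ last v0 p = v.
  by case/connectP: (econ v0 v) => p pp ->; exists p.
have Wp v : path e v0 (W v) by case: (WP v).
have Wl v : last v0 (W v) = v by case: (WP v).
pose m1 x y := \sum_v shift 2%:R v0 (W v) x y.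
have m1C x y : m1 x y = m1 y x by apply: eq_bigr => v _; apply: shiftC.
have m1e x y : m1 x y != 0 -> e x y.
  move=> mxy; apply: contraTT mxy => exy; rewrite negbK /m1 big1 // => v _.
  by apply/eqP; apply: contraNT exy; apply: shift_edge.
have two s : (-1) ^+ s * 2%:R = - 2%:R :> 'Z_4.
  by rewrite -signr_odd; case: odd; apply/eqP.
have m1s x : \sum_y m1 x y = 2%:R + 2%:R *+ (x == v0) *+ #|V|.
  rewrite exchange_big /=.
  rewrite (eq_bigr (fun v => 2%:R *+ (x == v0) + 2%:R *+ (v == x))).
    by rewrite big_split /= sumr_const sumrMnr sum_eq_op addrC.
  by move=> v _; rewrite shift_sum // Wl two mulNrn opprK [v == x]eq_sym.
case: (boolP (odd #|V|)) H => [oV|eV] H; last first.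
  exists m1; split=> // x; rewrite m1s -mulrnA -[#|V|]odd_double_half (negbTE eV).
  rewrite add0n -muln2 mulnA mulnC 2!mulrnA.
  by have -> : 2%:R *+ 2 = 0 :> 'Z_4 by [apply/eqP]; rewrite !mul0rn addr0.
case: H => // nbip.
(* Without such an edge the parity of the walk lengths would be a 2-colouring. *)
have /existsP[x /existsP[y /andP[exy oxy]]] :
    [exists x, exists y, e x y && (odd (size (W x)) == odd (size (W y)))].
  apply: contraT; rewrite negb_exists => /forallP H; case: nbip.
  exists [set x | odd (size (W x))] => x y exy; rewrite !inE.
  by have := H x; rewrite negb_exists => /forallP/(_ y); rewrite exy.
pose s : 'Z_4 := (-1) ^+ size (W x).
have sy : (-1) ^+ size (W y) = s by rewrite -signr_odd -(eqP oxy) signr_odd.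
(* A shift by 1 around the odd closed walk from [v0] to [x], across to [y] and back. Equal parities
   make the sign on the returning part agree with [W y] read from [v0], again starting with 1. *)
pose d u w := shift 1 v0 (W x) u w + (shift s x [:: y] u w + shift 1 v0 (W y) u w).
have xyp : path e x [:: y] by rewrite /= exy.
exists (fun u w => m1 u w + d u w); split=> [u w|u w|u].
- by rewrite m1C /d !(shiftC _ _ _ u).
- apply: contraTT => euw; rewrite negbK.
  have Z v p a : path e v p -> shift a v p u w = 0.
    by move=> pp; apply/eqP; apply: contraNT euw; apply: shift_edge.
  rewrite /d !Z // !addr0; apply/eqP; apply: contraNeq euw; exact: m1e.
have S2 := shift_sum s u xyp.
rewrite /= big_split /= expr1 mulN1r mulNrn opprK in S2.
rewrite big_split /= m1s /d !big_split /= S2 !shift_sum // !Wl sy -/s !mulr1.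
have -> : (u == v0)%:R - s *+ (u == x) + (s *+ (u == x) + s *+ (u == y) +
    ((u == v0)%:R - s *+ (u == y))) = 2%:R *+ (u == v0).
  by rewrite addrA (addrA (_ - _)) subrK addrACA subrr addr0 -mulr2n -!mulrnA mulnC.
case: (u == v0); last by rewrite !mul0rn !addr0.
rewrite -[#|V|]odd_double_half oV -muln2 mulrnDr mulnC mulrnA.
have -> : 2%:R *+ 1 *+ 2 = 0 :> 'Z_4 by [apply/eqP]; rewrite mul0rn addr0.
by apply/eqP.
Qed.

End Labelings.

(** * Crossing edges on 5-cycles of a P_6-free graph *)

Section FiveCycles.

Variables (V : finType) (e : rel V).
Hypotheses (e_sym : symmetric e) (e_irr : irreflexive e).
Hypothesis e_deg : forall x y, e x y -> exists2 z, z != y & e x z.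
Hypothesis P6 : forall x0 x1 x2 x3 x4 x5 : V,
  e x0 x1 -> e x1 x2 -> e x2 x3 -> e x3 x4 -> e x4 x5 ->
  ~ e x0 x2 -> ~ e x0 x3 -> ~ e x0 x4 -> ~ e x0 x5 ->
  ~ e x1 x3 -> ~ e x1 x4 -> ~ e x1 x5 -> ~ e x2 x4 -> ~ e x2 x5 -> ~ e x3 x5 ->
  False.

Local Open Scope ring_scope.

Implicit Types (m : V -> V -> 'Z_4) (a b c d f g t w : V).

Local Ltac esy := solve [assumption | rewrite e_sym; assumption].
Local Ltac neq := solve [exact: isT | assumption | rewrite eq_sym; assumption
  | apply: (edge_e e_irr); esy].
Local Ltac dist := rewrite /= ?inE ?negb_or; do ?[apply/andP; split]; neq.
Local Ltac nonadj := let H := fresh in move=> H;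
  match goal with K : ~ _ |- _ => solve [apply: K; esy] end.

Lemma nbr_neq a b c : e a b -> ~ e a c -> b != c.
Proof. by move=> ab ac; apply/eqP => E; apply: ac; rewrite -E. Qed.

(** This and the next two lemmas restate [short_cycle_linked] as refutations; they are used below to
    exclude chords and further adjacencies. *)
Lemma crossing_tri m a b c : maximal e m -> ~~ linked m a b ->
  e a b -> e b c -> e c a -> False.
Proof.
move=> mm /negP X ab bc ca; apply: X.
apply: (@short_cycle_linked _ e e_sym e_irr m a [:: b; c; a]) => //.
- by rewrite /= ab bc ca.
- by dist.
- exact: mem_head.
- by rewrite !inE eqxx orbT.
Qed.

Lemma crossing_square m a b c d : maximal e m -> ~~ linked m a b ->
  e a b -> e b c -> e c d -> e d a -> a != c -> b != d -> False.
Proof.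
move=> mm /negP X ab bc cd da ac bd; apply: X.
apply: (@short_cycle_linked _ e e_sym e_irr m a [:: b; c; d; a]) => //.
- by rewrite /= ab bc cd da.
- by dist.
- exact: mem_head.
- by rewrite !inE eqxx orbT.
Qed.

Lemma crossing_hexagon m a b c d f g : maximal e m -> ~~ linked m a b ->
  e a b -> e b c -> e c d -> e d f -> e f g -> e g a ->
  uniq [:: b; c; d; f; g; a] -> False.
Proof.
move=> mm /negP X ab bc cd df fg ga u; apply: X.
apply: (@short_cycle_linked _ e e_sym e_irr m a [:: b; c; d; f; g; a]) => //.
- by rewrite /= ab bc cd df fg ga.
- exact: mem_head.
- by rewrite !inE eqxx orbT.
Qed.

Lemma crossing_butterfly m a b c d f w g x y : maximal e m ->
  e a b -> e b c -> e c d -> e d f -> e f a -> uniq [:: b; c; d; f; a] ->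
  e a w -> e w g -> e g a -> w \notin [:: b; c; d; f] -> g \notin [:: b; c; d; f] ->
  x \in [:: b; c; d; f; a] -> y \in [:: b; c; d; f; a] -> ~~ linked m x y -> False.
Proof.
move=> mm ab bc cd df fa u aw wg ga wC gC xC yC /negP X; apply: X.
apply: (@butterfly_linked _ e e_sym e_irr m a [:: b; c; d; f; a] [:: w; g; a]) => //.
- by rewrite /= ab bc cd df fa.
- by rewrite /= aw wg ga.
- by dist.
- move=> z; rewrite -[_ :: _]/([:: b; c; d; f] ++ [:: a]) mem_cat !mem_seq1.
  case/orP=> [zC|/eqP-> //]; rewrite !inE.
  by case/or3P=> /eqP E //; [move: wC | move: gC]; rewrite -E zC.
- by rewrite inE xC orbT.
- by rewrite inE yC orbT.
Qed.

Lemma label_linked m a b : m a b != 0 -> linked m a b.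
Proof. by move=> mab; apply: connect1. Qed.

Lemma crossing_label m a b : ~~ linked m a b -> m a b = 0.
Proof. by apply: contraNeq; apply: label_linked. Qed.

(* A vertex whose two edges on a 5-cycle are both crossing has a neighbour in
   its own component; following it out of the 5-cycle gives an induced P_6
   unless it closes a triangle, which is a butterfly. *)
Lemma one_crossing_edge m c0 c1 c2 c3 c4 : maximal e m ->
  uniq [:: c1; c2; c3; c4; c0] ->
  e c0 c1 -> e c1 c2 -> e c2 c3 -> e c3 c4 -> e c4 c0 ->
  ~~ linked m c0 c1 -> ~~ linked m c4 c0 -> False.
Proof.
move=> mm u e01 e12 e23 e34 e40 X01 X40.
have X10 : ~~ linked m c1 c0 by rewrite (linked_sym mm.1).
have X04 : ~~ linked m c0 c4 by rewrite (linked_sym mm.1).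
move: (u); rewrite /= !inE !negb_or.
case/and5P=> /and4P[d12 d13 d14 d10] /and3P[d23 d24 d20] /andP[d34 d30] d40 _.
(* The labels at [c0] sum to 2, so they do not all vanish; [w] is off the cycle because neither
   cycle neighbour of [c0] is linked to it and chords at [c0] are excluded. *)
have [w mw] : exists w, m c0 w != 0.
  apply/existsP; apply: contraT; rewrite negb_exists => /forallP H.
  have [_ _ /(_ c0)] := mm.1; rewrite big1 => [/eqP//|y _].
  by apply/eqP; have := H y; rewrite negbK.
have e0w : e c0 w by case: mm.1 => _ me _; apply: me.
have l0w := label_linked mw.
have w1 : w != c1 by apply: contraNneq X01 => <-.
have w4 : w != c4 by apply: contraNneq X04 => <-.
have n02 : ~ e c0 c2 by move=> H; apply: (crossing_tri mm X01 e01 e12); esy.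
have n03 : ~ e c0 c3 by move=> H; apply: (crossing_tri mm X40 e40 H); esy.
have n13 : ~ e c1 c3.
  by move=> H; apply: (crossing_square mm X01 e01 H e34 e40); neq.
have w2 : w != c2 := nbr_neq e0w n02.
have w3 : w != c3 := nbr_neq e0w n03.
have nw1 : ~ e w c1 by move=> H; apply: (crossing_tri mm X01 e01 (c := w)); esy.
have nw4 : ~ e w c4 by move=> H; apply: (crossing_tri mm X40 e40 (c := w)); esy.
have nw2 : ~ e w c2.
  by move=> H; apply: (crossing_square mm X01 e01 e12 (d := w)); first [esy | neq].
have nw3 : ~ e w c3.
  by move=> H; apply: (crossing_square mm X40 e40 e0w H); first [esy | neq].
have [|w' w'0 ew] := @e_deg w c0; first by esy.
have w'1 : w' != c1 := nbr_neq ew nw1.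
have w'2 : w' != c2 := nbr_neq ew nw2.
have w'3 : w' != c3 := nbr_neq ew nw3.
have w'4 : w' != c4 := nbr_neq ew nw4.
have n1 : ~ e w' c1.
  by move=> H; apply: (crossing_square mm X01 e01 (c := w') (d := w)); first [esy | neq].
have n2 : ~ e w' c2.
  move=> H; apply: (crossing_hexagon mm X40 e40 e0w ew H e23 e34); dist.
have n3 : ~ e w' c3.
  move=> H; apply: (crossing_hexagon mm X01 e01 e12 e23 (f := w') (g := w)); first [esy | dist].
case: (boolP (e w' c0)) => [ew0|/negP n0].
  apply: (crossing_butterfly mm e01 e12 e23 e34 e40 u e0w ew ew0 _ _ _ _ X01); rewrite ?inE ?eqxx ?orbT //; dist.
apply: (P6 (x0 := w') (x1 := w) (x2 := c0) (x3 := c1) (x4 := c2) (x5 := c3)) => //; esy.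
Qed.

(* By [one_crossing_edge] this is, up to rotation, the only way a 5-cycle can
   contain crossing edges: the two edges [z0 p0] and [p2 z1]. *)
Record house m (z0 p0 p1 p2 z1 : V) : Prop := House {
  house_uniq : uniq [:: p0; p1; p2; z1; z0];
  house_zp : e z0 p0; house_pp1 : e p0 p1; house_pp2 : e p1 p2;
  house_pz : e p2 z1; house_zz : e z1 z0;
  house_cr0 : ~~ linked m z0 p0; house_cr1 : ~~ linked m p2 z1 }.

(** The mirror symmetry, which transfers facts about [z0] and [p0] to [z1] and [p2]. *)
Lemma house_rev m z0 p0 p1 p2 z1 : maximal e m ->
  house m z0 p0 p1 p2 z1 -> house m z1 p2 p1 p0 z0.
Proof.
move=> mm [u e0 e1 e2 e3 e4 X0 X1]; move: u; rewrite /= !inE !negb_or.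
case/and5P=> /and4P[d12 d13 d14 d10] /and3P[d23 d24 d20] /andP[d34 d30] d40 _.
split; try esy; first by dist.
  by rewrite (linked_sym mm.1).
by rewrite (linked_sym mm.1).
Qed.

Section House.

Variables (m : V -> V -> 'Z_4) (z0 p0 p1 p2 z1 : V).
Hypotheses (mm : maximal e m) (hm : house m z0 p0 p1 p2 z1).

(** Each chord puts a crossing edge on a triangle, except [p0 p2], which puts one on the 4-cycle
    through [z0] and [z1]. *)
Lemma house_chords : [/\ ~ e z0 p1, ~ e z0 p2, ~ e z1 p0, ~ e z1 p1 & ~ e p0 p2].
Proof.
case: hm => u e0 e1 e2 e3 e4 X0 X1; move: u; rewrite /= !inE !negb_or.
case/and5P=> /and4P[d12 d13 d14 d10] /and3P[d23 d24 d20] /andP[d34 d30] d40 _.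
split=> H.
- by apply: (crossing_tri mm X0 (c := p1)); esy.
- by apply: (crossing_tri mm X1 (c := z0)); esy.
- by apply: (crossing_tri mm X0 (c := z1)); esy.
- by apply: (crossing_tri mm X1 (c := p1)); esy.
- by apply: (crossing_square mm X0 (c := p2) (d := z1)); first [esy | neq].
Qed.

(** Short cycles forbid adjacencies between the cycle and another neighbour [w] of [z0], apart from
    [z0] itself. For a second neighbour [w'] of [w], either [w' w z0] is a triangle forming a
    butterfly, or [w' w z0 p0 p1 p2] is an induced P_6. *)
Lemma house_roof w : e z0 w -> w = p0 \/ w = z1.
Proof.
have [n01 n02 n10 n11 npp] := house_chords.
case: hm => u e0 e1 e2 e3 e4 X0 X1; move: (u); rewrite /= !inE !negb_or.
case/and5P=> /and4P[d12 d13 d14 d10] /and3P[d23 d24 d20] /andP[d34 d30] d40 _.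
move=> ew; case: (eqVneq w p0) => [|wp0]; first by left.
case: (eqVneq w z1) => [|wz1]; first by right.
exfalso.
have wp1 : w != p1 := nbr_neq ew n01.
have wp2 : w != p2 := nbr_neq ew n02.
have nw0 : ~ e w p0 by move=> H; apply: (crossing_tri mm X0 e0 (c := w)); esy.
have nw1 : ~ e w p1.
  by move=> H; apply: (crossing_square mm X0 e0 e1 (d := w)); first [esy | neq].
have nw2 : ~ e w p2.
  by move=> H; apply: (crossing_square mm X1 e3 e4 ew H); neq.
have nwz : ~ e w z1.
  by move=> H; apply: (crossing_hexagon mm X0 e0 e1 e2 e3 (g := w)); first [esy | dist].
have [|w' w'0 ew'] := @e_deg w z0; first by esy.
have w'p0 : w' != p0 := nbr_neq ew' nw0.
have w'p1 : w' != p1 := nbr_neq ew' nw1.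
have w'p2 : w' != p2 := nbr_neq ew' nw2.
have w'z1 : w' != z1 := nbr_neq ew' nwz.
have n0 : ~ e w' p0.
  by move=> H; apply: (crossing_square mm X0 e0 (c := w') (d := w)); first [esy | neq].
have n1 : ~ e w' p1.
  move=> H; apply: (crossing_hexagon mm X1 e3 e4 ew ew' H); first [esy | dist].
have n2 : ~ e w' p2.
  move=> H; apply: (crossing_hexagon mm X0 e0 e1 e2 (f := w') (g := w)); first [esy | dist].
case: (boolP (e w' z0)) => [ew0|/negP n].
  by apply: (crossing_butterfly mm e0 e1 e2 e3 e4 u ew ew' ew0 _ _ _ _ X0);
    rewrite ?inE ?eqxx ?orbT //; dist.
by apply: (P6 (x0 := w') (x1 := w) (x2 := z0) (x3 := p0) (x4 := p1) (x5 := p2)) => //; esy.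
Qed.

End House.

Section House2.

Variables (m : V -> V -> 'Z_4) (z0 p0 p1 p2 z1 : V).
Hypotheses (mm : maximal e m) (hm : house m z0 p0 p1 p2 z1).

Lemma house_roof' w : e z1 w -> w = p2 \/ w = z0.
Proof. exact: house_roof (house_rev mm hm) w. Qed.

(** The argument of [house_roof] at [p0]: if [w] missed [p2], then [w' w p0] would be a butterfly
    triangle or [w' w p0 z0 z1 p2] an induced P_6. *)
Lemma house_shoulder w : e p0 w -> w != z0 -> e p2 w.
Proof.
have [n01 n02 n10 n11 npp] := house_chords mm hm.
have R0 := house_roof mm hm; have R1 := house_roof'.
case: hm => u e0 e1 e2 e3 e4 X0 X1; move: (u); rewrite /= !inE !negb_or.
case/and5P=> /and4P[d12 d13 d14 d10] /and3P[d23 d24 d20] /andP[d34 d30] d40 _.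
move=> ew wz0; apply: contraT => /negP nw2; exfalso.
have wp1 : w != p1 by apply: contra_not_neq nw2 => ->; esy.
have wp2 : w != p2 := nbr_neq ew npp.
have wz1 : w != z1 by apply: (nbr_neq ew); nonadj.
have wp0 : w != p0 by neq.
have N0 x : e z0 x -> x != p0 -> x != z1 -> False.
  by move=> /R0[] ->; rewrite eqxx.
have N1 x : e z1 x -> x != p2 -> x != z0 -> False.
  by move=> /R1[] ->; rewrite eqxx.
have nwz0 : ~ e w z0 by rewrite e_sym => H; apply: (N0 w).
have nwz1 : ~ e w z1 by rewrite e_sym => H; apply: (N1 w).
have nw1 : ~ e w p1.
  by move=> H; apply: (crossing_hexagon mm X0 e0 ew H e2 e3 e4); dist.
have [|w' w'0 ew'] := @e_deg w p0; first by esy.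
have w'p1 : w' != p1 := nbr_neq ew' nw1.
have w'p2 : w' != p2 by apply: (nbr_neq ew'); nonadj.
have w'z0 : w' != z0 := nbr_neq ew' nwz0.
have w'z1 : w' != z1 := nbr_neq ew' nwz1.
have n0 : ~ e w' z0 by rewrite e_sym => H; apply: (N0 w').
have n1 : ~ e w' z1 by rewrite e_sym => H; apply: (N1 w').
have n2 : ~ e w' p2.
  by move=> H; apply: (crossing_hexagon mm X1 e3 e4 e0 ew ew' H); dist.
case: (boolP (e w' p0)) => [ew0|/negP n].
  by apply: (crossing_butterfly mm e1 e2 e3 e4 e0 _ ew ew' ew0 _ _ _ _ X0);
    rewrite ?inE ?eqxx ?orbT //; dist.
apply: (P6 (x0 := w') (x1 := w) (x2 := p0) (x3 := z0) (x4 := z1) (x5 := p2)) => //;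
  first [esy | nonadj].
Qed.

Lemma sum_support (F : V -> 'Z_4) (s : seq V) : uniq s ->
  (forall y, y \notin s -> F y = 0) -> \sum_y F y = \sum_(y <- s) F y.
Proof.
move=> us F0; rewrite (bigID [in s]) /= [X in _ + X]big1 // addr0.
by rewrite big_uniq.
Qed.

(** By [house_roof] only two edges meet [z0], and the crossing one has label 0, so the other carries
    the whole sum. *)
Lemma house_ridge : m z0 z1 = 2%:R.
Proof.
have R0 := house_roof mm hm.
case: hm => u e0 e1 e2 e3 e4 X0 X1; move: (u); rewrite /= !inE !negb_or.
case/and5P=> /and4P[d12 d13 d14 d10] /and3P[d23 d24 d20] /andP[d34 d30] d40 _.
case: mm => -[_ me /(_ z0)] + _; rewrite (@sum_support _ [:: p0; z1]).
- by rewrite !big_cons big_nil (crossing_label X0) add0r addr0.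
- by dist.
move=> y; rewrite !inE negb_or => /andP[y0 y1]; apply/eqP.
by apply: contraT => /me/R0[] E; rewrite E eqxx in y0 y1.
Qed.

(** Since [t] is also adjacent to [p2], it can replace [p1] without affecting the crossing edges. *)
Lemma house_body t : e p0 t -> t != z0 -> house m z0 p0 t p2 z1.
Proof.
move=> et tz0; have e2t := house_shoulder et tz0.
have [n01 n02 n10 n11 npp] := house_chords mm hm.
case: hm => u e0 e1 e2 e3 e4 X0 X1; move: (u); rewrite /= !inE !negb_or.
case/and5P=> /and4P[d12 d13 d14 d10] /and3P[d23 d24 d20] /andP[d34 d30] d40 _.
have tz1 : t != z1 by apply: (nbr_neq et); nonadj.
by split; try esy; dist.
Qed.

(** A 5-cycle with a crossing edge has at least two labels 2; the ridge gives one, and the crossing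
    edges have label 0. *)
Lemma house_two : m p0 p1 = 2%:R \/ m p1 p2 = 2%:R.
Proof.
have r := house_ridge.
case: hm => u e0 e1 e2 e3 e4 X0 X1.
case: (eqVneq (m p0 p1) 2%:R) => [|n1]; first by left.
case: (eqVneq (m p1 p2) 2%:R) => [|n2]; first by right.
case/negP: (X0); apply: (@five_cycle_linked _ e e_sym e_irr m z0 [:: p0; p1; p2; z1; z0]) => //.
- by rewrite /= e0 e1 e2 e3 e4.
- have [mC _ _] := mm.1.
  rewrite /= (crossing_label X0) (crossing_label X1) (negbTE n1) (negbTE n2) (mC z1) r.
  by rewrite orbC.
- by rewrite mem_head.
- by rewrite !inE eqxx orbT.
Qed.

End House2.

(* The 4-cycle [p0 t p2 t'] lies in one component, and after shifting it by
   [k] the labels at [t] and at [t'] must still satisfy [house_two]. *)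
Lemma house_pair m z0 p0 t p2 z1 t' (k : 'Z_4) : maximal e m ->
  house m z0 p0 t p2 z1 -> e p0 t' -> t' != z0 -> t' != t ->
  (kills k [:: m p0 t; m t p2; m p2 t'; m t' p0] <= 1)%N ->
  (m p0 t + k == 2%:R) || (m t p2 - k == 2%:R).
Proof.
move=> mm hm et' t'z0 t't ka.
have hm' := house_body mm hm et' t'z0.
case: (hm) (hm') => u e0 e1 e2 e3 e4 X0 X1 [u' _ e1' e2' _ _ _ _].
move: (u) (u'); rewrite /= !inE !negb_or.
case/and5P=> /and4P[d12 d13 d14 d10] /and3P[d23 d24 d20] /andP[d34 d30] d40 _.
case/and5P=> /and4P[d12' _ _ _] /and3P[d23' _ _] _ _ _.
pose p := [:: t; p2; t'; p0].
have pp : path e p0 p by rewrite /= e1 e2 (e_sym p2) e2' (e_sym t') e1'.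
have up : uniq p by rewrite /p; dist.
have [//|//|mm' lE _] := shift_maximal e_sym e_irr mm pp up (erefl : last p0 p = p0) _ _ ka.
have t'p2 : t' != p2 by neq.
have t'p0 : t' != p0 by neq.
have ne (x y : V) : x != y -> (x == y = false) * (y == x = false).
  by move=> xy; rewrite [y == x]eq_sym (negbTE xy).
have Vt : shift k p0 p p0 t = k.
  by rewrite /= /same_edge !eqxx !(ne _ _ d12, ne _ _ d13, ne _ _ t't, ne _ _ t'p0,
    ne _ _ t'p2, ne _ _ d23) /= !mulr0n !addr0.
have Vt2 : shift k p0 p t p2 = - k.
  by rewrite /= /same_edge !eqxx !(ne _ _ d12, ne _ _ d13, ne _ _ t't, ne _ _ t'p0,
    ne _ _ t'p2, ne _ _ d23) /= !mulr0n !addr0 add0r.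
have H := house_two mm' (House u e0 e1 e2 e3 e4 (etrans (congr1 negb (lE _ _)) X0)
  (etrans (congr1 negb (lE _ _)) X1)).
by rewrite Vt Vt2 in H; case: H => ->; rewrite eqxx ?orbT.
Qed.

(** A finite check for [house_pair]: [x], [y] are the labels of [p0 t], [t p2], and [x'], [y'] those
    at [t']. The 4-cycle meets them in the order [x], [y], [y'], [x']. *)
Lemma shifted_pair_bool (x y x' y' : 'Z_4) :
  [==> (x == 2%:R) || (y == 2%:R), (x' == 2%:R) || (y' == 2%:R),
   (kills 1 [:: x; y; y'; x'] <= 1)%N ==> (x + 1 == 2%:R) || (y - 1 == 2%:R),
   (kills 3%:R [:: x; y; y'; x'] <= 1)%N ==> (x + 3%:R == 2%:R) || (y - 3%:R == 2%:R)
   => [&& (x - y) + (x - y) == 2%:R, x' - y' == - (x - y) &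
          ~~ ((x + x' == 2%:R) && (y + y' == 2%:R))]].
Proof.
by case: x y x' y' => -[|[|[|[]]]] ? // [] [|[|[|[]]]] ? // [] [|[|[|[]]]] ? //
  [] [|[|[|[]]]].
Qed.

(** Case distinction on the number of neighbours of [p0] other than [z0], which are all adjacent to
    [p2]: at least three, two, or only [p1]. *)
Lemma no_house m z0 p0 p1 p2 z1 : maximal e m -> house m z0 p0 p1 p2 z1 -> False.
Proof.
move=> mm hm; have hr := house_rev mm hm.
have [mC me ms] := mm.1.
have [n01 n02 n10 n11 npp] := house_chords mm hm.
have R0 := house_roof mm hm; have R1 := house_roof' mm hm.
have S0 := house_shoulder mm hm; have S2 := house_shoulder mm hr.
case: (hm) => u e0 e1 e2 e3 e4 X0 X1; move: (u); rewrite /= !inE !negb_or.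
case/and5P=> /and4P[d12 d13 d14 d10] /and3P[d23 d24 d20] /andP[d34 d30] d40 _.
have m0 : m p0 z0 = 0 by rewrite mC (crossing_label X0).
have m2 : m p2 z1 = 0 by rewrite (crossing_label X1).
have nbr2 x : e p2 x -> x != z1 -> e p0 x /\ x != z0.
  by move=> ex xz1; split; [apply: S2 | apply: (nbr_neq ex); nonadj].
pose diff t := m p0 t - m t p2.
have pair t t' : e p0 t -> t != z0 -> e p0 t' -> t' != z0 -> t' != t ->
    [/\ diff t + diff t = 2%:R, diff t' = - diff t &
        ~ (m p0 t + m p0 t' = 2%:R /\ m t p2 + m t' p2 = 2%:R)].
  move=> et tz et' tz' tt'.
  have ht := house_body mm hm et tz; have ht' := house_body mm hm et' tz'.
  have H k := house_pair (k := k) mm ht et' tz' tt'.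
  have two : (m p0 t == 2%:R) || (m t p2 == 2%:R).
    by case: (house_two mm ht) => ->; rewrite eqxx ?orbT.
  have two' : (m p0 t' == 2%:R) || (m t' p2 == 2%:R).
    by case: (house_two mm ht') => ->; rewrite eqxx ?orbT.
  have := shifted_pair_bool (m p0 t) (m t p2) (m p0 t') (m t' p2).
  rewrite two two'.
  move: (H 1) (H 3%:R); rewrite (mC p2 t') (mC t' p0) => /implyP-> /implyP-> /= /and3P[/eqP ? /eqP ? /negP N].
  by split=> // -[A B]; apply: N; rewrite A B !eqxx.
have e01 : e p0 p1 by []; have p1z0 : p1 != z0 by neq.
(* The crossing edges at [p0] and [p2] have label 0, so the common neighbours carry both sums. *)
have sums s : uniq s -> (forall y, e p0 y -> y != z0 -> y \in s) ->
    \sum_(y <- s) m p0 y = 2%:R /\ \sum_(y <- s) m y p2 = 2%:R.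
  move=> us cov; split.
    rewrite -(ms p0) (sum_support us) // => y ys; apply/eqP; apply: contraNT ys => my.
    by apply: cov (me _ _ my) _; apply: contraNneq my => ->; rewrite m0.
  rewrite -(ms p2) (sum_support us) => [|y ys]; first by apply: eq_bigr => y _.
  apply/eqP; apply: contraNT ys => my.
  have [|] := nbr2 y (me _ _ my); last exact: cov.
  by apply: contraNneq my => ->; rewrite m2.
case: (boolP [exists t, [&& e p0 t, t != z0 & t != p1]]) => [/existsP[t]|no_t].
  case/and3P=> et tz0 tp1; have [dd dt N] := pair p1 t e01 p1z0 et tz0 tp1.
  (* With three neighbours, [diff] would change sign between any two, so it would equal its own
     negative, although its double is 2. With exactly two, the sums at [p0] and [p2] contradict the
     last clause of [pair]. *)
  case: (boolP [exists t', [&& e p0 t', t' != z0, t' != p1 & t' != t]]) => [/existsP[t']|no_t'].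
    case/and4P=> et' tz0' tp1' tt'.
    have [_ dt' _] := pair p1 t' e01 p1z0 et' tz0' tp1'.
    have [_ dtt' _] := pair t t' et tz0 et' tz0' tt'.
    have E : diff p1 = - diff p1 by rewrite -[RHS]dt' dtt' dt opprK.
    by move: dd; rewrite {1}E addNr => /esym/eqP.
  have [||A B] := sums [:: p1; t].
  - by dist.
  - move=> y ey yz; apply: contraNT no_t'; rewrite !inE negb_or => /andP[y1 yt].
    by apply/existsP; exists y; rewrite ey yz y1 yt.
  by apply: N; move: A B; rewrite !big_cons !big_nil !addr0.
have only y : e p0 y -> y != z0 -> y = p1.
  move=> ey yz; apply/eqP; apply: contraNT no_t => y1.
  by apply/existsP; exists y; rewrite ey yz y1.
have [||A B] := sums [:: p1] => //.
  by move=> y ey /(only _ ey)->; rewrite mem_head.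
rewrite !big_seq1 in A B.
(* Both labels from [p1] to [p0] and [p2] are 2 and add up to 0, so [p1] has a further neighbour;
   following it gives a butterfly at [p1] or an induced P_6. *)
have [w mw] : exists w, [&& m p1 w != 0, w != p0 & w != p2].
  apply/existsP; apply: contraT; rewrite negb_exists => /forallP H.
  have := ms p1; rewrite (@sum_support _ [:: p0; p2]).
  - by rewrite !big_cons big_nil mC A B => /eqP.
  - by dist.
  move=> y; rewrite !inE negb_or => yy; apply/eqP; apply: contraT => my.
  by have := H y; rewrite my yy.
case/and3P: mw => /me ew wp0 wp2.
have nwz0 : ~ e w z0 by rewrite e_sym => /R0[] E; [rewrite E eqxx in wp0 | apply: n11; rewrite -E; esy].
have nwz1 : ~ e w z1 by rewrite e_sym => /R1[] E; [rewrite E eqxx in wp2 | apply: n01; rewrite -E; esy].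
have wz0 : w != z0 by apply: (nbr_neq ew); nonadj.
have wz1 : w != z1 by apply: (nbr_neq ew); nonadj.
have wp1 : w != p1 by neq.
have np0 y : y != z0 -> y != p1 -> ~ e y p0.
  by rewrite e_sym => yz y1 /only E; rewrite E ?eqxx in y1.
have np2 y : y != z1 -> y != p1 -> ~ e y p2.
  rewrite e_sym => yz y1 /nbr2[] // ey yz0; rewrite (only y) ?eqxx // in y1.
have nw0 := np0 w wz0 wp1.
have nw2 := np2 w wz1 wp1.
have [|w' w'1 ew'] := @e_deg w p1; first by esy.
have w'p0 : w' != p0 := nbr_neq ew' nw0.
have w'p2 : w' != p2 := nbr_neq ew' nw2.
have w'z0 : w' != z0 := nbr_neq ew' nwz0.
have w'z1 : w' != z1 := nbr_neq ew' nwz1.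
have n0 := np0 w' w'z0 w'1.
have nz0 : ~ e w' z0 by rewrite e_sym => /R0[] E; [rewrite E eqxx in w'p0 | rewrite E eqxx in w'z1].
have nz1 : ~ e w' z1 by rewrite e_sym => /R1[] E; [rewrite E eqxx in w'p2 | rewrite E eqxx in w'z0].
case: (boolP (e w' p1)) => [ew1|/negP n].
  by apply: (crossing_butterfly mm e2 e3 e4 e0 e1 _ ew ew' ew1 _ _ _ _ X0);
    rewrite ?inE ?eqxx ?orbT //; dist.
apply: (P6 (x0 := w') (x1 := w) (x2 := p1) (x3 := p0) (x4 := z0) (x5 := z1)) => //;
  first [esy | nonadj].
Qed.

(** Crossing edges are never consecutive, and one alone is impossible because the rest of the cycle
    would link its ends. What remains is a house, in one of two positions. *)
Lemma five_cycle_no_crossing m c0 c1 c2 c3 c4 : maximal e m ->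
  uniq [:: c1; c2; c3; c4; c0] ->
  e c0 c1 -> e c1 c2 -> e c2 c3 -> e c3 c4 -> e c4 c0 -> linked m c0 c1.
Proof.
move=> mm u e0 e1 e2 e3 e4; apply: contraT => X0; exfalso.
have lC := linked_sym mm.1.
move: (u); rewrite /= !inE !negb_or.
case/and5P=> /and4P[d12 d13 d14 d10] /and3P[d23 d24 d20] /andP[d34 d30] d40 _.
have l1 : linked m c1 c2.
  apply: contraT => X1; exfalso.
  by apply: (one_crossing_edge mm _ e1 e2 e3 e4 e0 X1 X0); dist.
have l4 : linked m c4 c0.
  apply: contraT => X4; exfalso.
  exact: (one_crossing_edge mm u e0 e1 e2 e3 e4 X0 X4).
case: (boolP (linked m c3 c4)) => [l3|X3]; last first.
  by apply: (@no_house m c0 c1 c2 c3 c4).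
case: (boolP (linked m c2 c3)) => [l2|X2]; last first.
  apply: (@no_house m c1 c0 c4 c3 c2) => //; split; first [esy | dist | by rewrite lC].
case/negP: X0; rewrite lC; apply: connect_trans l1 _; apply: connect_trans l2 _.
by apply: connect_trans l3 l4.
Qed.

End FiveCycles.

(** * Induced subgraphs and chordless cycles through an edge *)

Section Induced.

Variables (V : finType) (e : rel V).
Hypotheses (e_sym : symmetric e) (e_irr : irreflexive e).

(** The isomorphism required by [isomorphic] goes from the subset to the pattern, so it is the
    inverse of [f] on its image. *)
Lemma induced_copy k (h : rel 'I_k) (f : 'I_k -> V) : injective f ->
  (forall i j, e (f i) (f j) = h i j) -> ~ induced_free e h.
Proof.
move=> f_inj ef; apply; exists (f @: setT).
have fS i : f i \in f @: setT by apply: imset_f.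
pose g i : {x | x \in f @: setT} := exist _ (f i) (fS i).
have [g' gK g'K] : bijective g.
  apply: inj_card_bij => [i j /(congr1 val)/f_inj //|].
  by rewrite card_sig card_ord -[X in _ <= X]card_ord -cardsT leq_imset_card.
by exists g' => [|x y]; [exists g | rewrite -ef /= -[x in RHS]g'K -[y in RHS]g'K].
Qed.

(** The six vertices are automatically distinct: for nonconsecutive ones, some vertex is adjacent to
    exactly one of the two. *)
Lemma P6_free_induced x0 x1 x2 x3 x4 x5 : P_free 6 e ->
  e x0 x1 -> e x1 x2 -> e x2 x3 -> e x3 x4 -> e x4 x5 ->
  ~ e x0 x2 -> ~ e x0 x3 -> ~ e x0 x4 -> ~ e x0 x5 ->
  ~ e x1 x3 -> ~ e x1 x4 -> ~ e x1 x5 -> ~ e x2 x4 -> ~ e x2 x5 -> ~ e x3 x5 ->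
  False.
Proof.
move=> free e01 e12 e23 e34 e45 n02 n03 n04 n05 n13 n14 n15 n24 n25 n35.
have ne a b c : e b a -> ~ e c a -> b != c.
  by move=> ba ca; apply/eqP => E; apply: ca; rewrite -E.
have e54 : e x5 x4 by rewrite e_sym.
have e32 : e x3 x2 by rewrite e_sym.
have n52 : ~ e x5 x2 by rewrite e_sym.
pose s := [:: x5; x4; x3; x2; x1; x0].
have us : uniq s.
  have d35 := ne _ _ _ e32 n52.
  have d53 : x5 != x3 by rewrite eq_sym.
  have d54 := edge_e e_irr e54; have d32 := edge_e e_irr e32.
  have d43 : x4 != x3 by rewrite eq_sym (edge_e e_irr e34).
  have d21 : x2 != x1 by rewrite eq_sym (edge_e e_irr e12).
  have d10 : x1 != x0 by rewrite eq_sym (edge_e e_irr e01).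
  rewrite /s /= !inE !negb_or d54 d53 d43 d32 d21 d10.
  rewrite (ne _ _ _ e54 n24) (ne _ _ _ e54 n14) (ne _ _ _ e54 n04).
  rewrite (ne _ _ _ e45 n25) (ne _ _ _ e45 n15) (ne _ _ _ e45 n05).
  by rewrite (ne _ _ _ e34 n14) (ne _ _ _ e34 n04) (ne _ _ _ e23 n03).
apply: (@induced_copy 6 (@path_graph 6) (fun i => nth x0 s (rev_ord i))) free.
  move=> i j /eqP; rewrite nth_uniq ?ltn_ord // => /eqP E.
  by apply: rev_ord_inj; apply: val_inj.
have ef a b : ~ e a b -> e a b = false by move/negP/negbTE.
move=> [[|[|[|[|[|[|//]]]]]] ?] [[|[|[|[|[|[|//]]]]]] ?]; rewrite /path_graph /= ?subSS ?subn0 /= ?e_irr //;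
  first [exact: ef | by rewrite e_sym; first [exact: ef | idtac]].
Qed.

(** A shortest path from [x] to [y] avoiding the edge [x y] exists by two-edge connectivity;
    minimality excludes every chord but this edge. *)
Lemma induced_cycle_through x y : two_edge_connected e -> e x y ->
  exists p, [/\ path e x p, last x p = y, uniq (x :: p), 1 < size p &
    forall i j, i < j -> j <= size p -> e (nth x (x :: p) i) (nth x (x :: p) j) ->
      j = i.+1 \/ i = 0 /\ j = size p].
Proof.
move=> [_ e2] exy; pose g := del_edge e [set x; y].
have [_ gcon] : connected g.
  by apply: e2; apply/imsetP; exists (x, y); rewrite ?inE.
have ex : exists n, [exists p : n.-tuple V, path g x p && (last x p == y)].
  case/connectP: (gcon x y) => p pp lp; exists (size p); apply/existsP.
  by exists (in_tuple p); rewrite /= pp -lp eqxx.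
case: (ex_minnP ex) => n /existsP[p0 /andP[pp0 /eqP lp0]] min_n.
have min p : path g x p -> last x p = y -> n <= size p.
  move=> pp lp; apply: min_n; apply/existsP; exists (in_tuple p).
  by rewrite /= pp lp eqxx.
have gsub : subrel g e by move=> a b /andP[].
have [p [pp lp up sp]] : exists p, [/\ path g x p, last x p = y, uniq (x :: p) & size p = n].
  case: (shortenP pp0) lp0 => p pp up sub lp; exists p; split=> //.
  apply/eqP; rewrite eqn_leq min // andbT.
  by rewrite -(size_tuple p0) uniq_leq_size //; case/andP: up.
have xy : x != y by apply: edge_e exy.
have p1 : 1 < size p.
  case: p pp lp up {sp} => [|z [|//]] /=; first by move=> _ E; rewrite E eqxx in xy.
  by move=> pp lp; move: pp; rewrite lp /g /del_edge /= eqxx andbF.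
exists p; split=> //; first exact: sub_path pp.
move=> i j ij js eij.
case: (boolP (g (nth x (x :: p) i) (nth x (x :: p) j))) => [gij|].
  left; apply/eqP; rewrite eqn_leq ij andbT.
  case: j => // j in ij js eij gij *.
  have ip : i <= size p by lia.
  have jp : j < size p by lia.
  (* The shortcut along the chord; [j] has been lowered by one, so [drop j p] starts at its far
     end. *)
  have := min (take i p ++ drop j p); rewrite size_cat size_take_min size_drop -sp.
  have li : last x (take i p) = nth x (x :: p) i.
    by case: i ip {ij eij gij} => [|i] ip; rewrite ?take0 //= (take_nth x) // last_rcons.
  rewrite cat_path last_cat li (drop_nth x) //=.
  have pd : path g (nth x p j) (drop j.+1 p).
    by move: pp; rewrite -{1}(cat_take_drop j.+1 p) cat_path (take_nth x) // last_rcons => /andP[].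
  rewrite take_path // gij pd => /(_ isT).
  have -> : last (nth x p j) (drop j.+1 p) = y.
    by rewrite -lp -[in RHS](cat_take_drop j.+1 p) last_cat (take_nth x) // last_rcons.
  by move=> /(_ erefl); lia.
have pos k l : k <= size p -> l <= size p ->
    nth x (x :: p) k = nth x (x :: p) l -> k = l.
  by move=> kp lp' /eqP; rewrite nth_uniq //= => /eqP.
have yE : y = nth x (x :: p) (size p) by rewrite -lp (last_nth x).
rewrite /g /del_edge /= eij /= negbK set2_same_edge => /orP[] /andP[/eqP A /eqP B].
  right; split; first by apply/esym/(pos 0 i) => //; lia.
  by apply/esym/pos; rewrite // -yE.
by have := pos 0 j isT js A; lia.
Qed.

Lemma C_ge_free_cycle x y p k : C_ge_free k e -> 2 < k -> e x y -> path e x p ->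
  last x p = y -> uniq (x :: p) ->
  (forall i j, i < j -> j <= size p -> e (nth x (x :: p) i) (nth x (x :: p) j) ->
      j = i.+1 \/ i = 0 /\ j = size p) -> (size p).+1 < k.
Proof.
move=> free k2 exy pp lp up ind; rewrite ltnNge; apply/negP => kp.
have eE i j : i < j -> j <= size p ->
    e (nth x (x :: p) i) (nth x (x :: p) j) = (j == i.+1) || (i == 0) && (j == size p).
  move=> ij jp; apply/idP/idP => [/(ind _ _ ij jp)[->|[-> ->]]|]; rewrite ?eqxx ?orbT //.
  case/orP=> [/eqP jE|/andP[/eqP-> /eqP->]].
    by rewrite jE; apply: (pathP x pp); rewrite -jE.
  by rewrite -(last_nth x) lp.
have cE (i j : 'I_(size p).+1) : i < j ->
    cycle_graph i j = (j == i.+1 :> nat) || (i == 0 :> nat) && (j == size p :> nat).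
  move=> ij; have jk := ltn_ord j; rewrite /cycle_graph /= modn_small; last by lia.
  rewrite eq_sym; congr (_ || _); case: (ltngtP j (size p)) => jp; last 1 first.
  - by rewrite jp modnn andbT eq_sym.
  - by rewrite modn_small ?ltnS // andbF; lia.
  - by lia.
apply: (@induced_copy (size p).+1 (@cycle_graph (size p).+1)
  (fun i => nth x (x :: p) i)) (free _ kp).
  by move=> i j /eqP; rewrite nth_uniq //= => /eqP; apply: val_inj.
have cC i j : @cycle_graph (size p).+1 i j = cycle_graph j i.
  by rewrite /cycle_graph /= orbC.
move=> i j; case: (ltngtP i j) => [ij|ji|/val_inj->].
- by rewrite cE // eE // -ltnS.
- by rewrite e_sym cC cE // eE // -ltnS.
rewrite e_irr /cycle_graph /= orbb; apply/esym/negbTE; have := ltn_ord j.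
rewrite leq_eqVlt eqSS => /orP[/eqP->|lt]; first by rewrite modnn; lia.
by rewrite modn_small //; lia.
Qed.

(** A chordless cycle through the edge has 3, 4 or 6 vertices ([short_cycle_linked]), 5
    ([five_cycle_no_crossing]), or at least 7, when it contains an induced P_6. The last two cases
    cannot occur without induced cycles of length at least 5. *)
Lemma crossing_free m x y : two_edge_connected e -> P_free 6 e \/ C_ge_free 5 e ->
  maximal e m -> e x y -> linked m x y.
Proof.
move=> e2 free mm exy.
have [p [pp lp up p1 ind]] := induced_cycle_through e2 exy.
(* The list [p] omits [x], so these sizes stand for cycles on 3, 4 and 6 vertices. *)
have cyc : size p \in [:: 2; 3; 5] -> linked m x y.
  move=> sp; have yx : e y x by rewrite e_sym.
  apply: (@short_cycle_linked _ e e_sym e_irr m x (rcons p x)) => //.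
  - by rewrite rcons_path pp lp.
  - by rewrite rcons_uniq; move: up; rewrite /= andbC.
  - by rewrite last_rcons.
  - by rewrite size_rcons; move: sp; rewrite !inE !eqSS.
  - exact: mem_head.
  - by rewrite inE mem_rcons -lp mem_last orbT.
case: free => free; last first.
  by have := C_ge_free_cycle free isT exy pp lp up ind; move: p1 cyc;
     case: (size p) => [|[|[|[|]]]] // _ cyc _; apply: cyc.
(* After deleting [a b], the first step of a path from [a] to [b] leads to another neighbour of
   [a]. *)
have e_deg a b : e a b -> exists2 c, c != b & e a c.
  case: e2 => _ /(_ [set a; b]) H eab.
  have [|_ /(_ a b) /connectP[[|c q] /= qp lq]] := H.
  - by apply/imsetP; exists (a, b); rewrite ?inE.
  - by move: eab; rewrite lq e_irr.
  case/andP: qp => /andP[ac ne] _; exists c => //.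
  by apply: contraNneq ne => ->.
have fP6 x0 x1 x2 x3 x4 x5 := @P6_free_induced x0 x1 x2 x3 x4 x5 free.
case: p pp lp up p1 ind cyc => [|a [|b [|c [|d [|f [|g p]]]]]] // pp lp up _ ind cyc;
  try exact: cyc.
  move: pp lp => /= /and5P[xa ab bc cd _] dy; subst y.
  have u : uniq [:: a; b; c; d; x] by rewrite -(rot_uniq 4).
  have dx : e d x by rewrite e_sym.
  rewrite (linked_sym mm.1).
  have u' : uniq [:: x; a; b; c; d] by [].
  exact: (five_cycle_no_crossing e_sym e_irr e_deg fP6 mm u' dx xa ab bc cd).
exfalso; move: pp => /= /and5P[xa ab bc cd /andP[df _]].
have N i j : i.+1 < j -> j < 6 -> ~ e (nth x [:: x, a, b, c, d, f, g & p] i)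
     (nth x [:: x, a, b, c, d, f, g & p] j).
  by move=> ij j6 /ind[|||[]] /=; lia.
apply: (fP6 x a b c d f) => //; [exact: (N 0 2) | exact: (N 0 3) | exact: (N 0 4)
  | exact: (N 0 5) | exact: (N 1 3) | exact: (N 1 4) | exact: (N 1 5)
  | exact: (N 2 4) | exact: (N 2 5) | exact: (N 3 5)].
Qed.

End Induced.

(** * Passage from labelings to parity Hamiltonian cycles, necessity, and the equivalence *)

Lemma PHC_of_labeling (V : finType) (e : rel V) (m : V -> V -> 'Z_4) :
  symmetric e -> irreflexive e -> connected e -> feasible e m ->
  (forall x y, linked m x y) -> has_PHC_at_most 3 e.
Proof.
move=> e_sym e_irr [/card_gt0P[v0 _] _] [mC me ms] lk.
(* The representatives 0 to 3 serve as multiplicities, whence the bound 3. Degrees are 2 modulo 4: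
   even, as Euler's theorem requires, and twice an odd visit number. *)
pose r x y : nat := m x y.
have r0 x y : (0 < r x y) = (m x y != 0%R).
  by rewrite lt0n; congr negb.
have rsum x : (\sum_y r x y) %% 4 = 2.
  rewrite -(@val_Zp_nat 4) // natr_sum; under eq_bigr do rewrite natr_Zp.
  by rewrite ms.
have rC x y : r x y = r y x by rewrite /r mC.
have [|x|x y|p [pp lp up]] := @euler_closed_walk V e e_irr r v0 rC.
- by move=> x y; rewrite r0; apply: me.
- by have := rsum x; lia.
- by rewrite (eq_connect (e' := [rel x y | m x y != 0%R])) => [|a b]; [apply: lk | apply: r0].
exists v0, p; split=> [|f /imsetP[[x y] _ ->]]; last first.
  by rewrite count_walk_edges up -ltnS; apply: ltn_ord.
split=> // v; have := edge_use_degree e_irr v pp; rewrite lp.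
under eq_bigr do rewrite up.
by move/addIn; have := rsum v; rewrite /visit_number; lia.
Qed.

(** The length of the walk is a sum of |V| odd visit numbers, hence has the parity of |V|; a closed
    walk in a bipartite graph has even length. *)
Lemma PHC_bipartite_even (V : finType) (e : rel V) v0 p :
  is_PHC e v0 p -> bipartite e -> ~~ odd #|V|.
Proof.
move=> [[pp lp] vis] [A hA].
have -> : odd #|V| = odd (size p).
  rewrite -(sum_count_mem p) -sum1_card.
  elim/big_ind2: _ => [//|a b c d|v _]; last by rewrite vis.
  by rewrite !oddD => -> ->.
have side q u : path e u q -> odd (size q) = ((u \in A) != (last u q \in A)).
  elim: q u => [|w q IH] u /=; first by rewrite eqxx.
  by case/andP=> /hA uw /IH->; move: uw; do 3 case: (_ \in A).
by rewrite (side _ _ pp) lp eqxx.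
Qed.

Theorem theorem4p1 (V : finType) (e : rel V)
    (e_sym : symmetric e) (e_irr : irreflexive e)
    (e_2conn : two_edge_connected e)
    (e_free : P_free 6 e \/ C_ge_free 5 e) :
  has_PHC_at_most 3 e <-> ~~ odd #|V| \/ ~ bipartite e.
Proof.
split=> [[v0 [p [phc _]]]|parity].
  case: (boolP (odd #|V|)) => [oV|]; last by left.
  by right=> bip; have := PHC_bipartite_even phc bip; rewrite oV.
have econn : connected e by case: e_2conn.
have [m0 f0] := feasible_exists e_sym e_irr econn parity.
have [m mm] := maximal_exists f0.
apply: (PHC_of_labeling e_sym e_irr econn mm.1) => x y.
have [_ /(_ x y)] := econn; apply: connect_sub => a b.
exact: (crossing_free e_sym e_irr e_2conn e_free mm).
Qed.
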